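(* Let $n\ge 2$ and let $V=(V_1,\dots,V_n)$ be an $n$-tuple of isometries on a Hilbert space $\mathcal{H}$ such that $\mathcal{R}(V_i^{m_i}V_j^{m_j})=\mathcal{R}(V_j^{m_j}V_i^{m_i})$ and $\mathcal{R}(V_i^{*m_i}V_j^{m_j})=\mathcal{R}(V_j^{m_j}V_i^{*m_i})$ for all $m_i,m_j\in\mathbb{Z}_+$ and all $1\le i<j\le n$. Then there exist $2^n$ closed subspaces $\{\mathcal{H}_\Lambda:\Lambda\subseteq I_n\}$ of $\mathcal{H}$ (some possibly $\{0\}$), each reducing every $V_i$ ($1\le i\le n$), such that $$\mathcal{H}=\bigoplus_{\Lambda\subseteq I_n}\mathcal{H}_\Lambda ,$$ where, whenever $\mathcal{H}_\Lambda\ne\{0\}$, $V_j|_{\mathcal{H}_\Lambda}$ is unitary for $j\in I_n\setminus\Lambda$ and $V_i|_{\mathcal{H}_\Lambda}$ is a shift for $i\in\Lambda$. Moreover, for each $\Lambda\subseteq I_n$, $$\mathcal{H}_\Lambda=\bigoplus_{\boldsymbol p\in\mathbb{Z}_+^{|\Lambda|}}V_\Lambda^{\boldsymbol p}\Big(\bigcap_{\boldsymbol q\in\mathbb{Z}_+^{n-|\Lambda|}}V_{I_n\setminus\Lambda}^{\boldsymbol q}\,\mathcal{W}_\Lambda\Big),$$ and the decomposition is unique (i.e. if $\{\mathcal{K}_\Lambda:\Lambda\subseteq I_n\}$ is any family of closed subspaces, each reducing every $V_i$ ($1\le i\le n$), with $\mathcal{H}=\bigoplus_{\Lambda\subseteq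 I_n}\mathcal{K}_\Lambda$ and such that, whenever $\mathcal{K}_\Lambda\ne\{0\}$, $V_j|_{\mathcal{K}_\Lambda}$ is unitary for $j\in I_n\setminus\Lambda$ and $V_i|_{\mathcal{K}_\Lambda}$ is a shift for $i\in\Lambda$, then $\mathcal{K}_\Lambda=\mathcal{H}_\Lambda$ for every $\Lambda\subseteq I_n$).
   Context: All Hilbert spaces are complex and separable. $\mathbb{Z}_+$ is the set of non-negative integers; $\mathcal{R}(T)$ and $\mathcal{N}(T)$ denote the range and kernel of $T$. $\bigoplus$ denotes the orthogonal (Hilbert space) direct sum. A closed subspace $\mathcal{M}$ reduces $T$ if $T\mathcal{M}\subseteq\mathcal{M}$ and $T\mathcal{M}^\perp\subseteq\mathcal{M}^\perp$. An isometry $S$ on $\mathcal{K}$ is a shift if $\mathcal{K}=\bigoplus_{m\ge0}S^m\mathcal{W}$ for some closed subspace $\mathcal{W}$ with $S^k\mathcal{W}\perp S^l\mathcal{W}$ for $k\ne l$; equivalently $S^{*m}\to0$ strongly. $I_n=\{1,\dots,n\}$. For $\Lambda=\{i_1<\dots<i_l\}\subseteq I_n$ and $\boldsymbol p=(p_{i_1},\dots,p_{i_l})\in\mathbb{Z}_+^{|\Lambda|}$, $V_\Lambda^{\boldsymbol p}=V_{i_1}^{p_{i_1}}\cdots V_{i_l}^{p_{i_l}}$ (in increasing order of indices; an empty product is the identity). Likewise $V_{I_n\setminus\Lambda}^{\boldsymbol q}$ for $\boldsymbol q\in\mathbb{Z}_+^{n-|\Lambda|}$. $\mathcal{W}_i=\mathcal{N}(V_i^*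 )$, $\mathcal{W}_\Lambda=\bigcap_{i\in\Lambda}\mathcal{W}_i$ for $\Lambda\neq\emptyset$, and $\mathcal{W}_\emptyset=\mathcal{H}$. *)

(* Defs.v *)
From HB Require Import structures.
From mathcomp Require Import all_boot all_order all_algebra.
From mathcomp Require Import sesquilinear complex.
From mathcomp Require Import all_classical all_reals all_analysis.
Import Order.TTheory GRing.Theory Num.Theory Num.Def.
Import numFieldNormedType.Exports.

Set Implicit Arguments.
Unset Strict Implicit.
Unset Printing Implicit Defensive.

Local Open Scope classical_set_scope.
Local Open Scope ring_scope.

Definition separable_space (T : topologicalType) : Prop :=
  exists2 D : set T, countable D & dense D.

Section Hilbert.
Context {R : realType} {H : completeNormedModType R[i]}.

(* The form is linear in its first argument, conjugate-linear in the second. *)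
Variable dot : {dot H for conjC}.

Definition closed_subspace (M : set H) : Prop :=
  [/\ M 0, forall (a : R[i]) x y, M x -> M y -> M (a *: x + y) & closed M].

Definition closed_span (A : set H) : set H := smallest closed_subspace A.

Definition orthogonal_sets (M N : set H) : Prop :=
  forall x y, M x -> N y -> dot x y = 0.

Definition orthocompl (M : set H) : set H :=
  [set y | forall x, M x -> dot x y = 0].

(* X is the internal Hilbert direct sum of the M i: these are pairwise
   orthogonal, with closed linear span X. *)
Definition orthogonal_sum (I : Type) (M : I -> set H) (X : set H) : Prop :=
  (forall i j, i <> j -> orthogonal_sets (M i) (M j)) /\
  X = closed_span (\bigcup_i M i).

(* Every bounded operator T has an adjoint, by Riesz representation, and it is
   unique, so the default value of [get] is irrelevant for such T. *)
Definition adjoint (T : H -> H) (y : H) : H :=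
  get [set z | forall x, dot (T x) y = dot x z].

Definition kernel (T : H -> H) : set H := T @^-1` [set 0].

Definition reduces (M : set H) (T : H -> H) : Prop :=
  T @` M `<=` M /\ T @` orthocompl M `<=` orthocompl M.

(* The restriction of T to M, as an operator on M, is an isometry
   (respectively a unitary, a shift). *)
Definition isometry_on (M : set H) (T : H -> H) : Prop :=
  T @` M `<=` M /\ (forall x, M x -> `|T x| = `|x|).

Definition unitary_on (M : set H) (T : H -> H) : Prop :=
  isometry_on M T /\ T @` M = M.

Definition shift_on (M : set H) (T : H -> H) : Prop :=
  isometry_on M T /\
  exists W : set H, [/\ closed_subspace W, W `<=` M &
    orthogonal_sum (fun m : nat => iter m T @` W) M].

Section Tuple.
Context {n : nat}.
Variable V : 'I_n -> {linear H -> H}.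

(* V_{i_1}^{p_1} ... V_{i_l}^{p_l} for L = {i_1 < ... < i_l}: [enum_val] lists
   L in increasing order, and the factor of the least index is applied last. *)
Definition tuple_pow (L : {set 'I_n}) (p : {ffun 'I_#|L| -> nat}) : H -> H :=
  \big[(fun f g : H -> H => f \o g)/idfun]_(k < #|L|)
    iter (p k) (V (enum_val k)).

Definition wandering (L : {set 'I_n}) : set H :=
  \bigcap_(i in [set i | i \in L]) kernel (adjoint (V i)).

Definition wold_decomposition (M : {set 'I_n} -> set H) : Prop :=
  [/\ forall L, closed_subspace (M L),
      forall L i, reduces (M L) (V i),
      orthogonal_sum M [set: H] &
      forall L, M L <> [set 0] ->
        (forall j, j \notin L -> unitary_on (M L) (V j)) /\
        (forall i, i \in L -> shift_on (M L) (V i))].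

End Tuple.
End Hilbert.

(* Main.v *)
(* Each range V_i^k H turns out to reduce every V_j with j <> i, so the
   projections V_i^k V_i^{*k} commute with V_j and V_j^* for j <> i. Hence the
   summands of the classical Wold decompositions H = U_i + S_i, where U_i is the
   intersection of the ranges of the V_i^k, reduce all the V_j and are compatible
   with one another, and H_L is the intersection of the S_i for i in L and the
   U_j for j not in L. The only limiting argument is the projection theorem:
   every sum is shown to be total by proving that a vector orthogonal to all the
   summands is 0. *)
Require Import Defs.
From HB Require Import structures.
From mathcomp Require Import all_boot all_order all_algebra.
From mathcomp Require Import sesquilinear complex.
From mathcomp Require Import all_classical all_reals all_analysis.
Import Order.TTheory GRing.Theory Num.Theory Num.Def.
Import numFieldNormedType.Exports.
Local Open Scope classical_set_scope.
Local Open Scope ring_scope.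

Set Implicit Arguments.
Unset Strict Implicit.
Unset Printing Implicit Defensive.

(** The order on [R[i]] is partial, but its nonnegative elements are real, so the infimum of the
    real parts serves. *)
Lemma complex_inf (R : realType) (A : set R[i]) :
  A !=set0 -> (forall a, A a -> 0 <= a) ->
  exists d : R[i], (forall a, A a -> d <= a) /\
    (forall e, 0 < e -> exists2 a, A a & a < d + e).
Proof.
move=> [a0 Aa0] A_ge0.
have ReA a : A a -> a = (complex.Re a)%:C%C.
  by move=> /A_ge0/ger0_real/RRe_real.
have lbB : has_lbound [set complex.Re a | a in A].
  by exists 0 => _ [a /[dup] Aa /A_ge0 a_ge0 <-]; rewrite -ler0c -ReA.
exists (inf [set complex.Re a | a in A])%:C%C; split => [a Aa|e e_gt0].
  by rewrite (ReA _ Aa) lecR; apply: ge_inf => //; exists a.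
have eE : e = (complex.Re e)%:C%C by rewrite RRe_real// gtr0_real.
have Re_gt0 : 0 < complex.Re e by rewrite -ltcR -eE.
have [|_ [a Aa <-] lt_a] := @inf_adherent _ [set complex.Re a | a in A] _ Re_gt0.
  by split => //; exists (complex.Re a0), a0.
by exists a => //; rewrite eE (ReA _ Aa) -rmorphD ltcR.
Qed.

(** * Projections and orthogonal sums in a Hilbert space *)

Section HilbertSpace.
Context {R : realType} {H : completeNormedModType R[i]}.
Variable dot : {dot H for conjC}.
Hypothesis dotE : forall x : H, dot x x = `|x| ^+ 2.
Local Notation C := R[i].

Lemma dotC x y : dot x y = (dot y x)^*.
Proof. by rewrite hermC mul1r. Qed.

Lemma dot_eq0C x y : dot x y = 0 -> dot y x = 0.
Proof. by move=> xy0; rewrite dotC xy0 conjC0. Qed.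

Lemma dot_self0 x : dot x x = 0 -> x = 0.
Proof. by move=> /eqP; rewrite dnorm_eq0 => /eqP. Qed.

Lemma dot_injr x y : (forall z, dot z x = dot z y) -> x = y.
Proof.
move=> zxy; apply/eqP; rewrite -subr_eq0; apply/eqP/dot_self0.
by rewrite linearBr/= zxy subrr.
Qed.

(** Pythagoras for the residual of [x] along [y]. Nonnegativity of the left side gives
    Cauchy-Schwarz, and the decrease on the right drives the projection theorem. *)
Lemma dot_project x y : y != 0 ->
  dot (x - (dot x y / dot y y) *: y) (x - (dot x y / dot y y) *: y) =
  dot x x - `|dot x y| ^+ 2 / dot y y.
Proof.
move=> y0; have yy0 : dot y y != 0 by rewrite dnorm_eq0.
set a := _ / _; have xay : dot (x - a *: y) y = 0.
  by rewrite linearBl/= linearZl_LR/= /a divfK ?subrr.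
rewrite linearBr/= linearZr_LR/= xay mulr0 subr0 linearBl/= linearZl_LR/=.
by rewrite (dotC y x) /a mulrAC -normCK.
Qed.

Lemma cauchy_schwarz x y : `|dot x y| <= `|x| * `|y|.
Proof.
have [->|y0] := eqVneq y 0; first by rewrite linear0r !normr0 mulr0.
rewrite -(@ler_pXn2r _ 2) ?nnegrE ?mulr_ge0// exprMn -!dotE.
rewrite -ler_pdivrMr ?dnorm_gt0//.
by rewrite -subr_ge0 -dot_project// dnorm_ge0.
Qed.

Lemma orthocompl_closed_subspace (M : set H) : closed_subspace (orthocompl dot M).
Proof.
split => [x _|a x y Mx My z Mz|]; first exact: linear0r.
  by rewrite linearDr/= linearZr_LR/= Mx// My// mulr0 addr0.
move=> y cly x Mx; apply/eqP; rewrite -normr_eq0 eq_le normr_ge0 andbT.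
apply/ler_addgt0Pl => e e0; rewrite addr0.
(* The added 1 keeps the radius well defined when [x] is 0. *)
have d0 : 0 < e / (`|x| + 1) by rewrite divr_gt0// ltr_wpDl.
have [z [Mz]] := cly _ (nbhsx_ballx y _ d0).
rewrite -ball_normE/= => yz.
have -> : dot x y = dot x (y - z) by rewrite linearBr/= Mz// subr0.
apply: (le_trans (cauchy_schwarz _ _)).
apply: (@le_trans _ _ ((`|x| + 1) * `|y - z|)).
  by rewrite ler_wpM2r// lerDl.
by rewrite mulrC -ler_pdivlMr ?ltW// ltr_wpDl.
Qed.

(** Stated with the midpoint of [u] and [v], so that a lower bound on the midpoint becomes an upper
    bound on [u - v]. *)
Lemma parallelogram (u v : H) :
  dot (u - v) (u - v) =
  (dot u u + dot v v) *+ 2 - dot (2^-1 *: (u + v)) (2^-1 *: (u + v)) *+ 4.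
Proof.
have c4 : `|2^-1 : C| ^+ 2 *+ 4 = 1.
  by rewrite normfV normr_nat exprVn -natrX -mulr_natr mulVf// pnatr_eq0.
rewrite dnormZ -mulrnAl c4 mul1r dnormB dnormD.
by rewrite mulr2n addrKA.
Qed.

Lemma near_invn_lt (e : C) : 0 < e -> \forall k \near \oo, k.+1%:R^-1 < e.
Proof.
move=> e0; have eE : e = (complex.Re e)%:C%C by rewrite RRe_real// gtr0_real.
have Re_gt0 : 0 < complex.Re e by rewrite -ltcR -eE.
near=> k.
have -> : k.+1%:R^-1 = (k.+1%:R^-1)%:C%C :> C by rewrite fmorphV rmorph_nat.
rewrite eE ltcR; near: k.
exact: (near_infty_natSinv_lt (PosNum Re_gt0)).
Unshelve. all: by end_near. Qed.

(** Minimising through an isometry [f] has two uses: [f = idfun] gives the projection onto [M], and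
    taking [M] to be the whole space gives adjoints. A minimising sequence is Cauchy in [M] itself
    because [f] preserves distances. *)
Lemma approximation (f : {linear H -> H}) (M : set H) (y : H) :
    (forall x, `|f x| = `|x|) -> closed_subspace M ->
  exists2 z, M z &
    forall x, M x -> dot (y - f z) (y - f z) <= dot (y - f x) (y - f x).
Proof.
move=> f_iso [M0 MP Mcl].
pose N x := dot (y - f x) (y - f x).
have N_ge0 x : 0 <= N x by exact: dnorm_ge0.
have [d [d_le d_lt]] : exists d : C, (forall a, (N @` M) a -> d <= a) /\
    (forall e, 0 < e -> exists2 a, (N @` M) a & a < d + e).
  apply: complex_inf; first by exists (N 0), 0.
  by move=> _ [x _ <-]; exact: N_ge0.
have {}d_le x : M x -> d <= N x by move=> Mx; apply: d_le; exists x.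
have {}d_lt k : exists z, M z /\ N z < d + k.+1%:R^-1.
  have [|_ [z Mz <-] Nz] := d_lt k.+1%:R^-1; first by rewrite invr_gt0 ltr0n.
  by exists z.
have [u uP] := choice d_lt.
have dist_u k l : `|u k - u l| ^+ 2 < (k.+1%:R^-1 + l.+1%:R^-1) *+ 2.
  have [[Mk Nk] [Ml Nl]] := (uP k, uP l).
  rewrite -f_iso -dotE linearB/=.
  have -> : f (u k) - f (u l) = (y - f (u l)) - (y - f (u k)).
    by rewrite opprB [RHS]addrC addrA subrK.
  rewrite parallelogram.
  (* The midpoint of two residuals is the residual of the midpoint, which lies in [M]; its squared
     norm is therefore at least [d]. *)
  have -> : 2^-1 *: (y - f (u l) + (y - f (u k))) =
            y - f (2^-1 *: (1 *: u l + u k)).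
    rewrite addrACA -opprD scale1r -(linearD f) scalerDr linearZ/= scalerN.
    by rewrite -mulr2n -(scaler_nat _ y) scalerA mulVf ?scale1r// pnatr_eq0.
  have Mh : M (2^-1 *: (1 *: u l + u k)).
    by rewrite -[_ *: _]addr0; exact: MP (MP _ _ _ Ml Mk) M0.
  rewrite ltrBlDr.
  apply: (@lt_le_trans _ _ ((d + l.+1%:R^-1 + (d + k.+1%:R^-1)) *+ 2)).
    by rewrite ltrMn2r/= ltrD.
  rewrite addrACA mulrnDl (addrC l.+1%:R^-1) [leLHS]addrC lerD2l.
  by rewrite -mulr2n -mulrnA lerMn2r d_le.
have u_cauchy : cauchy (u @ \oo).
  apply/cauchy_ballP => e e0.
  (* The bound [dist_u] doubles a sum of two reciprocals, so keeping each below a quarter of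
     [e ^+ 2] suffices. *)
  have e4 : 0 < e ^+ 2 / 4 by rewrite divr_gt0 ?exprn_gt0.
  rewrite near_map2; near=> k l; rewrite -ball_normE/=.
  rewrite -(@ltr_pXn2r _ 2) ?nnegrE ?(ltW e0)//.
  apply: (lt_trans (dist_u k l)).
  have -> : e ^+ 2 = (e ^+ 2 / 4 + e ^+ 2 / 4) *+ 2.
    by rewrite -mulr2n -mulrnA -[RHS]mulr_natr divfK ?pnatr_eq0.
  rewrite ltrMn2r/= ltrD//.
    by near: k; exact: near_invn_lt.
  by near: l; exact: near_invn_lt.
have /cauchy_cvgP/cvg_ex [z uz] := u_cauchy.
have Mz : M z.
  by apply: (closed_cvg _ Mcl _ _ uz); apply: nearW => k; have [] := uP k.
have fu : (y - f (u k)) @[k --> \oo] --> y - f z.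
  apply: cvgB; first exact: cvg_cst.
  apply/cvgrPdist_lt => e e0; move/cvgrPdist_lt: uz => /(_ e e0).
  by apply: filterS => k; rewrite -linearB f_iso.
have Nu : (N (u k)) @[k --> \oo] --> N z.
  rewrite /N dotE expr2; under eq_fun do rewrite dotE expr2.
  by apply: cvgM; apply: cvg_norm.
(* Since [d] bounds [N x] from below, [N z <= d + e] is enough: one half of [e] covers
   [N z - N (u k)], the other [N (u k) - d]. *)
exists z => // x /d_le; apply: le_trans; apply/ler_addgt0Pl => e e0.
have e2 : 0 < e / 2 by rewrite divr_gt0.
near \oo => k.
have [_ /ltW Nk] := uP k.
rewrite -/(N z) -(subrK (N (u k)) (N z)) [e in e + d]splitr -[leRHS]addrA.
apply: lerD.
  have NzR : N z - N (u k) \is Num.real by apply: realB; exact: ger0_real.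
  apply: (le_trans (real_ler_norm NzR)).
  by apply: ltW; near: k; move/cvgrPdist_lt: Nu; apply.
apply: (le_trans Nk); rewrite [leLHS]addrC lerD2r; apply: ltW.
by near: k; exact: near_invn_lt.
Unshelve. all: by end_near. Qed.

(** If [f x] were not orthogonal to the residual at the minimiser [z], moving [z] by the multiple
    [a *: x] would strictly decrease the distance. *)
Lemma orthogonal_projection (f : {linear H -> H}) (M : set H) (y : H) :
    (forall x, `|f x| = `|x|) -> closed_subspace M ->
  exists2 z, M z & forall x, M x -> dot (f x) (y - f z) = 0.
Proof.
move=> f_iso Mcs; have [z Mz zmin] := approximation y f_iso Mcs.
exists z => // x Mx; apply: dot_eq0C.
have [->|fx0] := eqVneq (f x) 0; first exact: linear0r.
set r := y - f z; pose a := dot r (f x) / dot (f x) (f x).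
have := zmin (a *: x + z); have [_ MP _] := Mcs.
have -> : y - f (a *: x + z) = r - a *: f x.
  by rewrite linearP opprD addrA addrAC.
move=> /(_ (MP _ _ _ Mx Mz)); rewrite dot_project// lerBrDl gerDr.
rewrite pmulr_lle0 ?invr_gt0 ?dnorm_gt0// => le0.
by apply/eqP; rewrite -normr_eq0 -sqrf_eq0 eq_le le0 exprn_ge0.
Qed.

Lemma closed_subspaceT : closed_subspace [set: H].
Proof. by split => //; exact: closedT. Qed.

Lemma closed_subspaceI (M N : set H) :
  closed_subspace M -> closed_subspace N -> closed_subspace (M `&` N).
Proof.
move=> [M0 MP Mcl] [N0 NP Ncl]; split => //; last exact: closedI.
by move=> a x y [Mx Nx] [My Ny]; split; [exact: MP|exact: NP].
Qed.

Lemma closed_subspace_bigcap (I : Type) (D : set I) (M : I -> set H) :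
  (forall i, D i -> closed_subspace (M i)) ->
  closed_subspace (\bigcap_(i in D) M i).
Proof.
move=> Mcs; split => [i /Mcs[]//|a x y Mx My i Di|].
  by have [_ MP _] := Mcs i Di; apply: MP; [exact: Mx|exact: My].
by apply: closed_bigI => i /Mcs[].
Qed.

Lemma closed_subspaceB (M : set H) x y :
  closed_subspace M -> M x -> M y -> M (x - y).
Proof.
by move=> [_ MP _] Mx My; rewrite addrC -scaleN1r; exact: MP.
Qed.

Lemma orthogonal_split (M : set H) (y : H) : closed_subspace M ->
  exists2 z, M z & orthocompl dot M (y - z).
Proof. exact: (@orthogonal_projection idfun). Qed.

Lemma orthocomplK (M : set H) : closed_subspace M ->
  orthocompl dot (orthocompl dot M) `<=` M.
Proof.
move=> Mcs y My; have [z Mz yz] := orthogonal_split y Mcs.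
have /dot_self0/eqP : dot (y - z) (y - z) = 0.
  by rewrite linearBr/= My// (dot_eq0C (yz _ Mz)) subrr.
by rewrite subr_eq0 => /eqP ->.
Qed.

(** Polarisation: norms of sums determine [dot x y + dot y x], and replacing [x] by ['i *: x]
    determines the difference. *)
Lemma isometry_dot (f : {linear H -> H}) : (forall x, `|f x| = `|x|) ->
  forall x y, dot (f x) (f y) = dot x y.
Proof.
move=> f_iso x y.
have ff z : dot (f z) (f z) = dot z z by rewrite !dotE f_iso.
have re a b : dot (f a) (f b) + dot (f b) (f a) = dot a b + dot b a.
  have := ff (a + b); rewrite linearD !linearDl/= !linearDr/= !ff.
  by rewrite -!addrA => /addrI; rewrite !addrA => /addIr.
have im := re ('i *: x) y; have {}re := re x y.
move: im; rewrite linearZ !linearZl_LR/= !linearZr_LR/= conjCi !mulNr -!mulrBr.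
move=> /(mulfI (neq0Ci _)) im; apply: (@mulIf _ 2); first by rewrite pnatr_eq0.
rewrite !mulr_natr !mulr2n.
have := congr2 +%R re im.
by rewrite addrACA subrr addr0 addrACA subrr addr0.
Qed.

(** The value of the adjoint at [y] is the [z] for which [f z] is the projection of [y] onto the
    range of [f]. *)
Lemma isometry_adjoint (f : {linear H -> H}) : (forall x, `|f x| = `|x|) ->
  forall x y, dot (f x) y = dot x (adjoint dot f y).
Proof.
move=> f_iso x y; have [z _ zP] := orthogonal_projection y f_iso closed_subspaceT.
apply: (@getPex _ [set z | forall x, dot (f x) y = dot x z]).
exists z => w; have /eqP := zP w I.
by rewrite linearBr/= isometry_dot// subr_eq0 => /eqP.
Qed.

Lemma orthogonal_sumP (I : Type) (M : I -> set H) (X : set H) :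
  closed_subspace X -> (forall i, M i `<=` X) ->
  (forall i j, i <> j -> orthogonal_sets dot (M i) (M j)) ->
  (forall x, X x -> (forall i y, M i y -> dot y x = 0) -> x = 0) ->
  orthogonal_sum dot M X.
Proof.
move=> Xcs MX Mo Mtot; split => //; rewrite eqEsubset; split; last first.
  by move=> x; apply; split => // y [i _]; exact: MX.
move=> x Xx Y [Ycs MY].
(* Projecting onto the intersection with [X] keeps the remainder in [X], where totality applies. *)
have [z [Yz Xz] xz] := orthogonal_split x (closed_subspaceI Ycs Xcs).
have /eqP : x - z = 0.
  apply: Mtot; first exact: closed_subspaceB.
  by move=> i y My; apply: xz; split; [apply: MY; exists i|exact: MX My].
by rewrite subr_eq0 => /eqP ->.
Qed.

(** The orthogonal complement of [x] is a closed subspace containing every [M i], hence [X], so [x]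
    is orthogonal to itself. *)
Lemma orthogonal_sum_total (I : Type) (M : I -> set H) (X : set H) x :
  orthogonal_sum dot M X -> X x -> (forall i y, M i y -> dot y x = 0) -> x = 0.
Proof.
move=> [_ ->] Xx Mx; apply: dot_self0.
have := Xx (orthocompl dot [set x]); apply; last by [].
split; first exact: orthocompl_closed_subspace.
by move=> y [i _ My] _ ->; exact: dot_eq0C (Mx i y My).
Qed.

(** * Tuples of isometries with commuting range projections *)

Section AdjointTuple.
Context {n : nat}.
Variables V A : 'I_n -> {linear H -> H}.
Hypothesis adjVA : forall i x y, dot (V i x) y = dot x (A i y).
Hypothesis AVK : forall i, cancel (V i) (A i).

Lemma adjAV i x y : dot (A i x) y = dot x (V i y).
Proof. by rewrite dotC -adjVA -dotC. Qed.

Lemma iter_adj i k x y : dot (iter k (V i) x) y = dot x (iter k (A i) y).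
Proof. by elim: k y => // k IH y; rewrite iterS adjVA IH -iterSr. Qed.

Lemma iter_AVK i k : cancel (iter k (V i)) (iter k (A i)).
Proof. by elim: k => // k IH x; rewrite iterSr iterS AVK IH. Qed.

(** This is the orthogonal projection onto the range of the [k]-th power of [V i], with [A i] in the
    role of the adjoint. *)
Definition range_proj i k x := iter k (V i) (iter k (A i) x).

Lemma range_projS i k x : range_proj i k.+1 x = V i (range_proj i k (A i x)).
Proof. by rewrite /range_proj iterS iterSr. Qed.

Lemma range_proj1 i x : range_proj i 1 x = V i (A i x).
Proof. by []. Qed.

Lemma range_projSV i k x : range_proj i k.+1 (V i x) = V i (range_proj i k x).
Proof. by rewrite range_projS AVK. Qed.

Lemma A_range_projS i k x : A i (range_proj i k.+1 x) = range_proj i k (A i x).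
Proof. by rewrite range_projS AVK. Qed.

Lemma range_proj_iter i k x : range_proj i k (iter k (V i) x) = iter k (V i) x.
Proof. by rewrite /range_proj iter_AVK. Qed.

Lemma iter_linear0 (f : {linear H -> H}) k : iter k f 0 = 0.
Proof. by elim: k => //= k ->; rewrite linear0. Qed.

Lemma range_projB i k x y :
  range_proj i k (x - y) = range_proj i k x - range_proj i k y.
Proof.
have iterB (f : {linear H -> H}) m u v :
    iter m f (u - v) = iter m f u - iter m f v.
  by elim: m => //= m ->; rewrite linearB.
by rewrite /range_proj !iterB.
Qed.

Lemma range_proj_adj i k x y : dot (range_proj i k x) y = dot x (range_proj i k y).
Proof. by rewrite /range_proj iter_adj [RHS]dotC iter_adj -dotC. Qed.

Lemma range_proj_lel i k l x : (k <= l)%N ->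
  range_proj i k (range_proj i l x) = range_proj i l x.
Proof.
elim: k l x => // k IH [//|l] x kl.
by rewrite range_projS A_range_projS IH// -range_projS.
Qed.

Lemma range_proj_ler i k l x : (k <= l)%N ->
  range_proj i l (range_proj i k x) = range_proj i l x.
Proof.
by move=> kl; apply: dot_injr => z; rewrite -!range_proj_adj range_proj_lel.
Qed.

(* A range that is invariant under both V j and its adjoint reduces V j, hence
   its projection commutes with them. *)
Lemma range_proj_comm i j k :
  (forall x, exists y, V j (iter k (V i) x) = iter k (V i) y) ->
  (forall x, exists y, A j (iter k (V i) x) = iter k (V i) y) ->
  (forall x, range_proj i k (V j x) = V j (range_proj i k x)) /\
  (forall x, range_proj i k (A j x) = A j (range_proj i k x)).
Proof.
move=> invV invA.
have PVP x : range_proj i k (V j (range_proj i k x)) = V j (range_proj i k x).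
  by have [y xy] := invV (iter k (A i) x); rewrite {2 3}/range_proj xy range_proj_iter.
have PAP x : range_proj i k (A j (range_proj i k x)) = A j (range_proj i k x).
  by have [y xy] := invA (iter k (A i) x); rewrite {2 3}/range_proj xy range_proj_iter.
(* With P the projection, the adjoint of [PAP] reads P V P = P V, which combines with [PVP] into P V
   = V P; exchanging [V j] and [A j] gives the other half. *)
split=> x; apply: dot_injr => z.
- by rewrite -range_proj_adj -adjAV -PAP range_proj_adj adjAV range_proj_adj PVP.
- by rewrite -range_proj_adj -adjVA -PVP range_proj_adj adjVA range_proj_adj PAP.
Qed.

(** * Reducing subspaces and the Wold summands of a single isometry *)

Section DoublyCommuting.
Hypothesis range_projV : forall i j k x, i != j ->
  range_proj i k (V j x) = V j (range_proj i k x).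
Hypothesis range_projA : forall i j k x, i != j ->
  range_proj i k (A j x) = A j (range_proj i k x).

(** For closed subspaces this amounts to reducing [V j], by [stable_reduces] and [reduces_stable],
    but it passes more easily to intersections and complements. *)
Definition stable (M : set H) j := forall x, M x -> M (V j x) /\ M (A j x).

Lemma stable_orthocompl M j : stable M j -> stable (orthocompl dot M) j.
Proof.
move=> Ms x Mx; split=> y My.
  by rewrite -adjAV; apply: Mx; have [] := Ms y My.
by rewrite -adjVA; apply: Mx; have [] := Ms y My.
Qed.

Lemma stable_iterV M j k x : stable M j -> M x -> M (iter k (V j) x).
Proof. by move=> Ms Mx; elim: k => // k IH; have [] := Ms _ IH. Qed.

Lemma stable_iterA M j k x : stable M j -> M x -> M (iter k (A j) x).
Proof. by move=> Ms Mx; elim: k => // k IH; have [] := Ms _ IH. Qed.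

Lemma stable_range_proj M j k x : stable M j -> M x -> M (range_proj j k x).
Proof. by move=> Ms Mx; apply: stable_iterV => //; exact: stable_iterA. Qed.

Lemma stable_reduces M j : stable M j -> reduces dot M (V j).
Proof.
move=> Ms; split=> _ [x Mx <-]; first by have [] := Ms x Mx.
by have [] := stable_orthocompl Ms Mx.
Qed.

Lemma reduces_stable M j : closed_subspace M -> reduces dot M (V j) -> stable M j.
Proof.
move=> Mcs [VM VMo] x Mx; split; first by apply: VM; exists x.
apply: orthocomplK => // y My.
by rewrite -adjVA; apply: dot_eq0C; apply: (VMo (V j y)) => //; exists y.
Qed.

(** A projection fixes exactly the vectors of its range, so this is the intersection of the ranges
    of all powers of [V i]. *)
Definition unitary_part i : set H := [set x | forall k, range_proj i k x = x].

Definition shift_part i : set H := orthocompl dot (unitary_part i).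

(* The subspace V_i^m W_i. *)
Definition shell i m : set H :=
  [set x | range_proj i m x = x /\ range_proj i m.+1 x = 0].

Definition shell_proj i m x := range_proj i m x - range_proj i m.+1 x.

(** By self-adjointness, the vectors fixed by a projection P are those orthogonal to every y - P
    y. *)
Lemma unitary_part_closed i : closed_subspace (unitary_part i).
Proof.
have -> : unitary_part i =
    orthocompl dot [set p.1 - range_proj i p.2 p.1 | p in [set: H * nat]].
  rewrite eqEsubset; split=> x xP => [_ [[y k] _ <-]|k] /=.
    by rewrite linearBl/= range_proj_adj xP subrr.
  apply: dot_injr => y; apply/esym/eqP; rewrite -subr_eq0 -range_proj_adj -linearBl.
  by apply/eqP/xP; exists (y, k).
exact: orthocompl_closed_subspace.
Qed.

Lemma unitary_part_stable i j : stable (unitary_part i) j.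
Proof.
move=> x Ux; have [<-|ij] := eqVneq i j; last first.
  by split=> k; rewrite ?range_projV ?range_projA ?Ux.
(* For [j = i] the exponent moves by one instead: P_{k+1} V = V P_k and P_k A = A P_{k+1}. *)
split=> [[//|k]|k]; first by rewrite range_projSV Ux.
by rewrite -A_range_projS Ux.
Qed.

Lemma shift_part_stable i j : stable (shift_part i) j.
Proof. exact/stable_orthocompl/unitary_part_stable. Qed.

Lemma shell_stable i m j : i != j -> stable (shell i m) j.
Proof.
move=> ij x [xm xm1]; split; split;
  by rewrite ?range_projV ?range_projA// ?xm ?xm1 ?linear0.
Qed.

Lemma shell_shift_part i m : shell i m `<=` shift_part i.
Proof.
move=> x [_ x0] u Uu.
by rewrite -(Uu m.+1) range_proj_adj x0 linear0r.
Qed.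

Lemma shell_projP i m x : shell i m (shell_proj i m x).
Proof.
split; rewrite range_projB; first by rewrite !range_proj_lel.
by rewrite range_proj_ler// range_proj_lel// subrr.
Qed.

Lemma shell_proj_id i m x : shell i m x -> shell_proj i m x = x.
Proof. by rewrite /shell_proj => -[-> ->]; rewrite subr0. Qed.

Lemma shell_proj_adj i m x y : dot (shell_proj i m x) y = dot x (shell_proj i m y).
Proof. by rewrite linearBl linearBr/= !range_proj_adj. Qed.

(** For [l < m] the projection with exponent [l.+1] kills the first shell and fixes the second. *)
Lemma shell_orthogonal i l m : l <> m -> orthogonal_sets dot (shell i l) (shell i m).
Proof.
wlog lm : l m / (l < m)%N => [IH /eqP|_].
  rewrite neq_ltn => /orP[lm|ml].
    by apply: IH => //; apply/eqP; rewrite ltn_eqF.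
  by move=> x y xl ym; apply/dot_eq0C/(IH m l) => //; apply/eqP; rewrite ltn_eqF.
move=> x y [_ x0] [ym _].
by rewrite -ym -(range_proj_lel i y lm) -range_proj_adj x0 linear0l.
Qed.

(** The shell projections telescope, starting from the identity at exponent 0. *)
Lemma shell_proj_eq0 i x : (forall m, shell_proj i m x = 0) -> unitary_part i x.
Proof.
move=> x0; elim=> // k IH.
by move/eqP: (x0 k); rewrite subr_eq0 IH => /eqP.
Qed.

Lemma unitary_shift_part0 i x : unitary_part i x -> shift_part i x -> x = 0.
Proof. by move=> Ux /(_ x Ux)/dot_self0. Qed.

Lemma shell0E i x : shell i 0 x <-> A i x = 0.
Proof.
split=> [[_]|Ax0]; last by split; rewrite ?range_proj1 ?Ax0 ?linear0.
by rewrite range_proj1 => /(congr1 (A i)); rewrite AVK linear0.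
Qed.

Lemma shell_iterV i m x : shell i 0 x -> shell i m (iter m (V i) x).
Proof.
move=> /shell0E Ax0; split; first exact: range_proj_iter.
by rewrite /range_proj [iter m.+1 (A i) _]iterS iter_AVK Ax0 iter_linear0.
Qed.

Lemma shell_iterA i m x : shell i m x -> shell i 0 (iter m (A i) x).
Proof.
move=> [_ x0]; apply/shell0E; rewrite -iterS -[LHS](iter_AVK i m.+1).
by rewrite -/(range_proj i m.+1 x) x0 iter_linear0.
Qed.

Lemma shellB i m x y : shell i m x -> shell i m y -> shell i m (x - y).
Proof.
by move=> [xm x0] [ym y0]; split; rewrite range_projB ?xm ?ym// x0 y0 subrr.
Qed.

Lemma stable_shell_proj (M : set H) i m x : stable M i ->
  (forall y z, M y -> M z -> M (y - z)) -> M x -> M (shell_proj i m x).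
Proof. by move=> Ms MB Mx; apply: MB; exact: stable_range_proj. Qed.

(** * The joint decomposition into the subspaces [part L] *)

Definition component (L : {set 'I_n}) i : set H :=
  if i \in L then shift_part i else unitary_part i.

Definition part (L : {set 'I_n}) : set H := \bigcap_i component L i.

Lemma component_closed L i : closed_subspace (component L i).
Proof.
rewrite /component; case: ifP => _; last exact: unitary_part_closed.
exact: orthocompl_closed_subspace.
Qed.

Lemma component_stable L i j : stable (component L i) j.
Proof.
rewrite /component; case: ifP => _; last exact: unitary_part_stable.
exact: shift_part_stable.
Qed.

Lemma part_closed L : closed_subspace (part L).
Proof. by apply: closed_subspace_bigcap => i _; exact: component_closed. Qed.

Lemma part_stable L j : stable (part L) j.
Proof. by move=> x Lx; split=> i _; have [] := component_stable j (Lx i I). Qed.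

Lemma part_shift (L : {set 'I_n}) i x : i \in L -> part L x -> shift_part i x.
Proof. by move=> iL /(_ i I); rewrite /component iL. Qed.

Lemma part_unitary (L : {set 'I_n}) i x : i \notin L -> part L x -> unitary_part i x.
Proof. by move=> /negPf iL /(_ i I); rewrite /component iL. Qed.

Lemma part_orthogonal L L' : L <> L' -> orthogonal_sets dot (part L) (part L').
Proof.
move=> LL' x y Lx L'y.
have [i LL'i] : exists i, (i \in L) != (i \in L').
  apply/existsP; apply: contra_notT LL'; rewrite negb_exists => /forallP LL'.
  by apply/setP => i; have := LL' i; rewrite negbK => /eqP.
move: LL'i; have [iL|iL] := boolP (i \in L); have [iL'|iL'] := boolP (i \in L') => // _.
  by apply/dot_eq0C/(part_shift iL Lx)/(part_unitary iL' L'y).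
exact/(part_shift iL' L'y)/(part_unitary iL Lx).
Qed.

(** Compatibility of the Wold decompositions for [i] and [k]: the projection onto [unitary_part k]
    preserves both summands for [i]. *)
Lemma component_split L i k u v : unitary_part k u -> shift_part k v ->
  component L i (u + v) -> component L i u.
Proof.
move: u v.
have unit_split u v : unitary_part k u -> shift_part k v ->
    unitary_part i (u + v) -> unitary_part i u.
  move=> Uu Sv Uuv l; apply/eqP; rewrite -subr_eq0; apply/eqP.
  have PvS := stable_range_proj l (@shift_part_stable k i) Sv.
  have PuU := stable_range_proj l (@unitary_part_stable k i) Uu.
  apply: (@unitary_shift_part0 k).
    exact: closed_subspaceB (unitary_part_closed k) PuU Uu.
  (* The left side lies in [unitary_part k] and the right side in [shift_part k], so both vanish. *)
  have -> : range_proj i l u - u = v - range_proj i l v.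
    by rewrite -[in range_proj i l u](addrK v u) range_projB Uuv (addrC u) addrAC addrK.
  exact: closed_subspaceB (orthocompl_closed_subspace _) Sv PvS.
rewrite /component; case: ifP => // _ u v Uu Sv Suv w Uw.
(* The shift case follows by duality: the projection [w1] of [w] stays in [unitary_part i] by the
   case just proved, and pairing [w] with [u] equals pairing [w1] with [u + v]. *)
have [w1 Uw1 Sw2] := orthogonal_split w (unitary_part_closed k).
have Uiw1 : unitary_part i w1.
  by apply: (unit_split _ (w - w1)) => //; rewrite addrC subrK.
have -> : dot w u = dot w1 (u + v) + dot (w - w1) u - dot w1 v.
  by rewrite linearDr linearBl/= addrAC addrK addrC subrK.
by rewrite Suv// (dot_eq0C (Sw2 _ Uu)) (Sv _ Uw1) subr0 addr0.
Qed.

Lemma part_total x : (forall L y, part L y -> dot y x = 0) -> x = 0.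
Proof.
(* The list [s] holds the indices for which [x] is not yet known to lie in one summand. Each step
   splits [x] along one index [k], kills the unitary component by induction, then treats [x] as a
   vector of [shift_part k]. *)
suff part_total_seq (s : seq 'I_n) L : (forall L y, part L y -> dot y x = 0) ->
    (forall i, i \notin s -> component L i x) -> x = 0.
  by move=> xo; apply: (part_total_seq (enum 'I_n) finset.set0 xo) => i; rewrite mem_enum.
elim: s x L => [|k s IH] x L xo xL.
  by apply: dot_self0; apply: (xo L) => i _; exact: xL.
have [u Uu Sv] := orthogonal_split x (unitary_part_closed k).
have uo L' y : part L' y -> dot y u = 0.
  move=> L'y; have [kL'|kL'] := boolP (k \in L').
    by apply/dot_eq0C/(part_shift kL' L'y).
  have := Sv y (part_unitary kL' L'y).
  by rewrite linearBr/= (xo L')// sub0r => /eqP; rewrite oppr_eq0 => /eqP.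
have uL i : i \notin s -> component (L :\ k) i u.
  move=> iS; have [->|ik] := eqVneq i k; first by rewrite /component !inE eqxx.
  rewrite /component !inE ik/= -/(component L i).
  apply: (component_split Uu Sv); rewrite addrC subrK.
  by apply: xL; rewrite inE negb_or ik.
have u0 := IH u _ uo uL.
move: Sv; rewrite u0 subr0 => Sx.
apply: (IH x (k |: L)) => // i iS.
have [->|ik] := eqVneq i k; first by rewrite /component !inE eqxx.
rewrite /component !inE (negPf ik)/= -/(component L i).
by apply: xL; rewrite inE negb_or ik.
Qed.

Lemma part_sum : orthogonal_sum dot part [set: H].
Proof.
apply: orthogonal_sumP => //; first exact: part_orthogonal.
by move=> x _; exact: part_total.
Qed.

Lemma V_isometry i x : `|V i x| = `|x|.
Proof.
by apply/eqP; rewrite -(@eqrXn2 _ 2)// -!dotE adjVA AVK.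
Qed.

Lemma part_unitary_on (L : {set 'I_n}) j : j \notin L -> unitary_on (part L) (V j).
Proof.
move=> jL; have VL : V j @` part L `<=` part L.
  by move=> _ [x Lx <-]; have [] := part_stable j Lx.
split; first by split => // x _; exact: V_isometry.
rewrite eqEsubset; split => // x Lx; exists (A j x).
  by have [] := part_stable j Lx.
by rewrite -range_proj1; exact: part_unitary jL Lx 1.
Qed.

Lemma part_shift_on (L : {set 'I_n}) i : i \in L -> shift_on dot (part L) (V i).
Proof.
move=> iL; split.
  split => [_ [x Lx <-]|x _]; last exact: V_isometry.
  by have [] := part_stable i Lx.
exists (part L `&` [set x | A i x = 0]); split.
- apply: closed_subspaceI; first exact: part_closed.
  (* The kernel of the adjoint is closed, being the orthogonal complement of the range. *)
  have -> : [set x | A i x = 0] = orthocompl dot (range (V i)).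
    rewrite eqEsubset; split=> x /= => [Ax0 _ [y _ <-]|xo].
      by rewrite adjVA Ax0 linear0r.
    by apply: dot_self0; rewrite -adjVA; apply: xo; exists (A i x).
  exact: orthocompl_closed_subspace.
- by move=> x [].
apply: orthogonal_sumP.
- exact: part_closed.
- move=> m _ [x [Lx _] <-]; exact: (stable_iterV m (@part_stable L i) Lx).
- move=> l m lm _ _ [x [_ /shell0E xW] <-] [y [_ /shell0E yW] <-].
  exact: (shell_orthogonal lm (shell_iterV l xW) (shell_iterV m yW)).
(* Each shell projection of [x] stays in [part L] and is the [m]-th power of [V i] applied to a
   wandering vector, so it is orthogonal to [x] and hence 0; thus [x] lies in both Wold summands for
   [i]. *)
move=> x Lx xo; apply: (@unitary_shift_part0 i); last exact: part_shift iL Lx.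
apply: shell_proj_eq0 => m; apply: dot_self0.
have Qx := shell_projP i m x.
rewrite -shell_proj_adj (shell_proj_id Qx); apply: (xo m).
exists (iter m (A i) (shell_proj i m x)); last by have [] := Qx.
split; last exact/shell0E/shell_iterA.
apply: (stable_iterA m (@part_stable L i)).
apply: (stable_shell_proj m (@part_stable L i) _ Lx).
by move=> y z; exact: closed_subspaceB (part_closed L).
Qed.

Lemma part_wold : wold_decomposition dot V part.
Proof.
split; [exact: part_closed| |exact: part_sum|].
  by move=> L i; apply: stable_reduces; exact: part_stable.
by move=> L _; split=> i; [exact: part_unitary_on|exact: part_shift_on].
Qed.

(** * Uniqueness of the decomposition *)

Lemma unitary_on_unitary_part K i : unitary_on K (V i) -> K `<=` unitary_part i.
Proof.
move=> [_ VK] x Kx k.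
have [y _ <-] : exists2 y, K y & iter k (V i) y = x.
  elim: k => [|k [y Ky <-]]; first by exists x.
  by move: Ky; rewrite -{1}VK => -[z Kz <-]; exists z; rewrite // iterSr.
exact: range_proj_iter.
Qed.

(* W is contained in the kernel of the adjoint: for w in W, the vector A i w
   lies in K and is orthogonal to every V_i^m W. *)
Lemma shift_on_shift_part K i : stable K i -> shift_on dot K (V i) ->
  K `<=` shift_part i.
Proof.
move=> Ks [_ [W [_ WK WS]]].
have AW0 w : W w -> A i w = 0.
  move=> Ww; apply: (orthogonal_sum_total WS).
    by have [] := Ks w (WK w Ww).
  move=> m _ [y Wy <-]; rewrite -adjVA -iterS.
  have [Wo _] := WS; by apply: (Wo m.+1 0%N) => //; exists w.
move=> x Kx u Uu.
(* The orthogonal complement of [u] is a closed subspace containing every V_i^m W, since these lie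
   in shells; hence it contains [K]. *)
move: Kx; have [_ ->] := WS => /(_ (orthocompl dot [set u])) xu.
apply: xu => //; split; first exact: orthocompl_closed_subspace.
move=> _ [m _ [w Ww <-]] _ ->.
have Wm : shell i m (iter m (V i) w) by exact/shell_iterV/shell0E/AW0.
exact: (shell_shift_part Wm Uu).
Qed.

Lemma wold_sub_part K : wold_decomposition dot V K -> forall L, K L `<=` part L.
Proof.
move=> [Kcs Kred Ksum KP] L x Kx.
have [K0|/KP[Ku Ks]] := pselect (K L = [set 0]).
  by move: Kx; rewrite K0 => ->; have [] := part_closed L.
move=> i _; rewrite /component; case: ifPn => iL.
  by apply: shift_on_shift_part (Ks i iL) _ Kx; exact: reduces_stable.
exact: unitary_on_unitary_part (Ku i iL) _ Kx.
Qed.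

(** A vector of [part L] orthogonal to [K L] is also orthogonal to every other [K L'], which lies in
    [part L']; totality of the family [K] makes it 0. *)
Lemma wold_unique K : wold_decomposition dot V K -> forall L, K L = part L.
Proof.
move=> KW L; have Ksub := wold_sub_part KW; have [Kcs _ Ksum _] := KW.
rewrite eqEsubset; split; first exact: Ksub.
move=> x Lx; have [z Kz xz] := orthogonal_split x (Kcs L).
have Lxz : part L (x - z) by exact: closed_subspaceB (part_closed L) Lx (Ksub _ _ Kz).
have /eqP : x - z = 0.
  apply: (orthogonal_sum_total Ksum) => // L' y Ky.
  have [LL'|LL'] := eqVneq L' L; first by apply: xz; rewrite -LL'.
  by apply: (part_orthogonal _ (Ksub _ _ Ky) Lxz); apply/eqP.
by rewrite subr_eq0 => /eqP ->.
Qed.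

(** * The explicit formula for [part L], with [core L] as its generating subspace *)

Definition core (L : {set 'I_n}) : set H :=
  [set x | (forall i, i \in L -> A i x = 0) /\
           (forall j, j \notin L -> unitary_part j x)].

Lemma core_sub_part L : core L `<=` part L.
Proof.
move=> x [xW xU] i _; rewrite /component; case: ifPn => iL; last exact: xU.
exact/(@shell_shift_part i 0)/shell0E/xW.
Qed.

Lemma wandering_stable (L : {set 'I_n}) j : j \notin L ->
  stable [set x | forall i, i \in L -> A i x = 0] j.
Proof.
move=> jL x xW; have /= xs i (iL : i \in L) : shell i 0 (V j x) /\ shell i 0 (A j x).
  apply: shell_stable; last exact/shell0E/xW.
  by apply: contraNneq jL => <-.
by split=> i iL; apply/shell0E; have [] := xs i iL.
Qed.

Lemma core_stable (L : {set 'I_n}) j : j \notin L -> stable (core L) j.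
Proof.
move=> jL x [xW xU]; have [VW AW] := wandering_stable jL xW.
by split; split=> // i iL; have [] := unitary_part_stable j (xU i iL).
Qed.

Lemma tuple_pow_stable (L : {set 'I_n}) (p : {ffun 'I_#|L| -> nat}) (M : set H) :
  (forall i, i \in L -> stable M i) -> forall x, M x -> M (tuple_pow V p x).
Proof.
move=> Ms; rewrite /tuple_pow.
elim/big_ind: _ => [//|f g Mf Mg x Mx|k _ x]; first exact/Mf/Mg.
by apply: stable_iterV; apply: Ms; exact: enum_valP.
Qed.

(** Only the factor at [k] moves [M] into [N]: the factors applied before it preserve [M], those
    applied after it preserve [N]. *)
Lemma tuple_pow_map (L : {set 'I_n}) (p : {ffun 'I_#|L| -> nat})
    (k : 'I_#|L|) (M N : set H) :
  (forall i, enum_val k != i -> stable M i /\ stable N i) ->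
  (forall x, M x -> N (iter (p k) (V (enum_val k)) x)) ->
  forall x, M x -> N (tuple_pow V p x).
Proof.
move=> MNs MN; rewrite /tuple_pow.
have : k \in index_enum 'I_#|L| by rewrite mem_index_enum.
have ev l : k != l -> enum_val k != enum_val l.
  by apply: contra_neq => /enum_val_inj.
elim: (index_enum _) (index_enum_uniq 'I_#|L|) => //= l r IH /andP[lr ur].
rewrite inE => /orP[/eqP kl|kr] x Mx; rewrite big_cons/=; last first.
  apply: stable_iterV (IH ur kr x Mx); apply: (proj2 (MNs _ _)).
  by apply: ev; apply: contraNneq lr => <-.
(* Here the factor at [k] heads the list, hence acts last; the tail has only other indices and stays
   in [M]. *)
subst l; apply: MN; move: lr {IH ur}; elim: r => [|l r IH]; first by rewrite big_nil.
rewrite inE negb_or => /andP[kl kr]; rewrite big_cons/=.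
by apply: stable_iterV (IH kr); apply: (proj1 (MNs _ _)); exact: ev.
Qed.

(** The exponent at each index can be read off from the shell of the image, which makes images for
    distinct exponents orthogonal. *)
Lemma tuple_pow_core (L : {set 'I_n}) (p : {ffun 'I_#|L| -> nat}) k x :
  core L x -> shell (enum_val k) (p k) (tuple_pow V p x).
Proof.
move=> [xW _].
apply: (@tuple_pow_map _ _ k (shell (enum_val k) 0)).
- by move=> i ki; split; exact: shell_stable.
- by move=> y; exact: shell_iterV.
by apply/shell0E/xW; exact: enum_valP.
Qed.

(** Membership in all the images forces membership in the ranges of all powers of [V j] for [j]
    outside [L]; conversely each such [V j] maps [core L] onto itself. *)
Lemma bigcap_tuple_pow_wandering (L : {set 'I_n}) :
  \bigcap_(q in [set: {ffun 'I_#|~: L| -> nat}])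
    tuple_pow V q @` [set x | forall i, i \in L -> A i x = 0] = core L.
Proof.
rewrite eqEsubset; split=> x xq.
  split.
    have [y yW <-] := xq [ffun=> 0%N] I.
    apply: (@tuple_pow_stable _ _ [set z | forall i, i \in L -> A i z = 0]) => // j.
    by rewrite inE; exact: wandering_stable.
  move=> j jL k; have jC : j \in ~: L by rewrite inE.
  (* The constant exponent [k] exhibits [x] in the range of the [k]-th power of [V j]. *)
  have [y _ <-] := xq [ffun=> k] I.
  apply: (@tuple_pow_map _ _ (enum_rank_in jC j) setT
    [set z | range_proj j k z = z]) => //.
    rewrite enum_rankK_in// => i ji; split=> // z /= zk.
    by rewrite range_projV// range_projA// zk.
  by move=> z _; rewrite ffunE enum_rankK_in//=; exact: range_proj_iter.
move=> q _.
suff [y yE <-] : exists2 y, core L y & tuple_pow V q y = x.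
  by exists y => //; case: yE.
move: x xq; rewrite /tuple_pow.
elim/big_ind: _ => [x Ex|f g Ef Eg x /Ef[y /Eg[z Ez <-] <-]|k _ x Ex].
- by exists x.
- by exists z.
have kL : enum_val k \notin L by have := enum_valP k; rewrite inE.
exists (iter (q k) (A (enum_val k)) x).
  by apply: stable_iterA => //; exact: core_stable.
by case: Ex => _ /(_ _ kL (q k)).
Qed.

Lemma tuple_pow_core_surj (L : {set 'I_n}) (p : {ffun 'I_#|L| -> nat}) x :
  (forall k, shell (enum_val k) (p k) x) ->
  (forall j, j \notin L -> unitary_part j x) ->
  exists2 y, core L y & tuple_pow V p y = x.
Proof.
move=> xs; rewrite /tuple_pow.
(* Exponents are set to 0 off the list of remaining factors: peeling off the outermost one sends its
   shell to shell 0, and an empty list leaves a vector of [core L]. *)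
have : forall k,
    shell (enum_val k) (if k \in index_enum 'I_#|L| then p k else 0%N) x.
  by move=> k; rewrite mem_index_enum.
elim: (index_enum _) (index_enum_uniq 'I_#|L|) x {xs} =>
  [_|l r IH /= /andP[lr ur]] x xs xU.
  exists x; last by rewrite big_nil.
  split=> // i iL; apply/shell0E.
  by have := xs (enum_rank_in iL i); rewrite enum_rankK_in.
have [|j jL|y Ey yx] := IH ur (iter (p l) (A (enum_val l)) x).
- move=> k; have [->|kl] := eqVneq k l.
    by rewrite (negPf lr); have := xs l; rewrite inE eqxx; exact: shell_iterA.
  have kls : enum_val k != enum_val l by apply: contra_neq kl => /enum_val_inj.
  apply: (stable_iterA _ (shell_stable kls)).
  by have := xs k; rewrite inE (negPf kl).
- exact: (stable_iterA _ (@unitary_part_stable j _) (xU j jL)).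
exists y => //; rewrite big_cons/= yx.
by have [+ _] := xs l; rewrite inE eqxx.
Qed.

Lemma part_tuple_pow_core (L : {set 'I_n}) :
  orthogonal_sum dot
    (fun p : {ffun 'I_#|L| -> nat} => tuple_pow V p @` core L) (part L).
Proof.
apply: orthogonal_sumP => [|p _ [x Ex <-]|p q pq _ _ [x Ex <-] [y Ey <-]|].
- exact: part_closed.
- by apply: tuple_pow_stable (core_sub_part Ex) => i _; exact: part_stable.
- have [k pqk] : exists k, p k != q k.
    apply/existsP; apply: contra_notT pq; rewrite negb_exists => /forallP pq.
    by apply/ffunP => k; have := pq k; rewrite negbK => /eqP.
  have := shell_orthogonal (elimN eqP pqk); apply; exact: tuple_pow_core.
move=> x Lx xo.
(* The list [s] holds the indices of [L] at which [y] is not yet confined to one shell; [p] records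
   the shell at the others. The initial [p] is arbitrary, as no index is settled at the start. *)
suff total_seq (s : seq 'I_#|L|) (p : {ffun 'I_#|L| -> nat}) y : part L y ->
    (forall (q : {ffun 'I_#|L| -> nat}) z,
      core L z -> dot (tuple_pow V q z) y = 0) ->
    (forall k, k \notin s -> shell (enum_val k) (p k) y) -> y = 0.
  have := total_seq (enum 'I_#|L|) [ffun=> 0%N] x Lx; apply.
    by move=> p z Ez; apply: (xo p); exists z.
  by move=> k; rewrite mem_enum.
elim: s p y {x Lx xo} => [|k s IH] p x Lx xo xs.
  have [|j jL|y Ey yx] := @tuple_pow_core_surj L p x; first by move=> k; exact: xs.
    exact: part_unitary jL Lx.
  by apply: dot_self0; rewrite -{1}yx xo.
apply: (@unitary_shift_part0 (enum_val k)); last exact: part_shift (enum_valP k) Lx.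
apply: shell_proj_eq0 => m.
apply: (IH [ffun l => if l == k then m else p l]).
- apply: (stable_shell_proj m (@part_stable L (enum_val k)) _ Lx).
  by move=> y z; exact: closed_subspaceB (part_closed L).
- move=> q z Ez; have zs := tuple_pow_core q k Ez.
  (* The shell projection fixes the image under [tuple_pow V q] when [q k = m]; otherwise the two
     vectors lie in orthogonal shells. *)
  have [qm|/eqP qm] := eqVneq (q k) m; last first.
    exact: (shell_orthogonal qm zs (shell_projP _ _ _)).
  by rewrite -shell_proj_adj shell_proj_id -?qm// xo.
move=> l ls; rewrite ffunE; have [->|lk] := eqVneq l k; first exact: shell_projP.
have ss : stable (shell (enum_val l) (p l)) (enum_val k).
  by apply: shell_stable; apply: contra_neq lk => /enum_val_inj.
apply: (stable_shell_proj m ss (@shellB _ _)).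
by apply: xs; rewrite inE negb_or lk.
Qed.

End DoublyCommuting.
End AdjointTuple.
End HilbertSpace.

(** * Passage from the range hypotheses to commuting projections *)

Lemma adjoint_linear (R : realType) (H : completeNormedModType R[i])
    (dot : {dot H for conjC}) (f : {linear H -> H}) :
  (forall x y, dot (f x) y = dot x (adjoint dot f y)) -> linear (adjoint dot f).
Proof.
move=> fP a x y; apply: (dot_injr (dot := dot)) => z.
by rewrite -fP !linearDr/= !linearZr_LR/= !fP.
Qed.

Theorem theorem5p5 (R : realType) (H : completeNormedModType R[i])
    (dot : {dot H for conjC})
    (dotE : forall x : H, dot x x = `|x| ^+ 2)
    (Hsep : separable_space H)
    (n : nat) (n_ge2 : (2 <= n)%N)
    (V : 'I_n -> {linear H -> H})
    (V_isometry : forall i (x : H), `|V i x| = `|x|)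
    (range_comm : forall i j : 'I_n, (i < j)%N -> forall mi mj : nat,
      range (iter mi (V i) \o iter mj (V j)) =
      range (iter mj (V j) \o iter mi (V i)))
    (range_adjoint_comm : forall i j : 'I_n, (i < j)%N -> forall mi mj : nat,
      range (iter mi (adjoint dot (V i)) \o iter mj (V j)) =
      range (iter mj (V j) \o iter mi (adjoint dot (V i)))) :
  exists M : {set 'I_n} -> set H,
    [/\ wold_decomposition dot V M,
        forall L : {set 'I_n},
          orthogonal_sum dot
            (fun p : {ffun 'I_#|L| -> nat} =>
               tuple_pow V p @`
                 (\bigcap_(q in [set: {ffun 'I_#|~: L| -> nat}])
                    tuple_pow V q @` wandering dot V L))
            (M L) &
        forall K : {set 'I_n} -> set H, wold_decomposition dot V K ->
          forall L : {set 'I_n}, K L = M L].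
Proof.
have adjP i := isometry_adjoint dotE (V_isometry i).
pose A i : {linear H -> H} := HB.pack (adjoint dot (V i))
  (GRing.isLinear.Build _ _ _ _ _ (adjoint_linear (adjP i))).
have adjVA i x y : dot (V i x) y = dot x (A i y) by exact: adjP.
have AVK i : cancel (V i) (A i).
  by move=> x; apply: (dot_injr (dot := dot)) => z; rewrite -adjVA (isometry_dot dotE).
have comm_le (i j : 'I_n) k : (i < j)%N ->
    (forall x, range_proj V A j k (V i x) = V i (range_proj V A j k x)) /\
    (forall x, range_proj V A j k (A i x) = A i (range_proj V A j k x)).
  move=> ij; apply: (range_proj_comm adjVA AVK) => x.
    have : range (iter 1 (V i) \o iter k (V j)) (V i (iter k (V j) x)) by exists x.
    by rewrite range_comm// => -[y _ <-]; exists (V i y).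
  have : range (iter 1 (A i) \o iter k (V j)) (A i (iter k (V j) x)) by exists x.
  by rewrite range_adjoint_comm// => -[y _ <-]; exists (A i y).
have comm_gt (i j : 'I_n) k : (i < j)%N ->
    (forall x, range_proj V A i k (V j x) = V j (range_proj V A i k x)) /\
    (forall x, range_proj V A i k (A j x) = A j (range_proj V A i k x)).
  move=> ij; apply: (range_proj_comm adjVA AVK) => x.
    have : range (iter 1 (V j) \o iter k (V i)) (V j (iter k (V i) x)) by exists x.
    by rewrite -range_comm// => -[y _ <-]; exists (V j y).
  (* The adjoint hypothesis covers only the adjoint of the smaller index, so invariance under [A j]
     goes through [comm_le]: V_j A_j V_i^k x = V_i^k V_j A_j x lies in the range of V_i^k V_j, which
     is that of V_j V_i^k, and V_j cancels. *)
  have PV l y : range_proj V A j 1 (iter l (V i) y) = iter l (V i) (range_proj V A j 1 y).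
    by elim: l => // l IH; rewrite !iterS (comm_le i j 1 ij).1 IH.
  have : range (iter k (V i) \o iter 1 (V j)) (range_proj V A j 1 (iter k (V i) x)).
    by rewrite PV; exists (A j x).
  rewrite range_comm// => -[y _ yx]; exists y.
  by rewrite -[LHS](AVK j) -(range_proj1 V A) -yx; exact: AVK.
have comm (i j : 'I_n) k : i != j ->
    (forall x, range_proj V A i k (V j x) = V j (range_proj V A i k x)) /\
    (forall x, range_proj V A i k (A j x) = A j (range_proj V A i k x)).
  by rewrite -val_eqE/= neq_ltn => /orP[/comm_gt|/comm_le].
have PV (i j : 'I_n) k x (ij : i != j) := (comm i j k ij).1 x.
have PA (i j : 'I_n) k x (ij : i != j) := (comm i j k ij).2 x.
exists (part dot V A); split.
- exact: part_wold.
- move=> L; have := part_tuple_pow_core dotE adjVA AVK PV PA L.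
  (* The set of common zeros of the [A i] is convertible with [wandering dot V L]. *)
  rewrite -(bigcap_tuple_pow_wandering AVK PV PA); exact.
- by move=> K KW; exact: wold_unique.
Qed.
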